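(* Let $G$ be a locally finite graph with a bipartition $V=V_1\sqcup V_2$ of its vertex set (so no edge joins two vertices of $V_1$ or two vertices of $V_2$). The following are equivalent: (i) $G$ admits a perfect matching; (ii) $G$ admits a dyadic graph derangement; (iii) $G$ admits a graph derangement; (iv) for every subset $J\subseteq V$, $\#J\leq\#N(J)$.
   Context: Write $x\sim y$ if $x,y$ are adjacent. A graph is locally finite if every vertex lies in finitely many edges (the vertex set may be infinite). For $J\subseteq V$, $N(J)=\{y\in V:\exists x\in J,\ x\sim y\}$. A perfect matching is a set of edges such that every vertex lies in exactly one of them. A graph derangement of $G$ is an injective map $f:V\to V$ with $f(v)\sim v$ for all $v$. Its cycles are the equivalence classes of the relation $x\approx y$ iff $f^m(x)=f^n(y)$ for some positive integers $m,n$; it is dyadic if every cycle has at most $2$ elements. *)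

(* Defs.v *)
From HB Require Import structures.
From mathcomp Require Import all_boot.
From mathcomp Require Import boolp classical_sets functions cardinality.

Set Implicit Arguments.
Unset Strict Implicit.
Unset Printing Implicit Defensive.

Local Open Scope classical_set_scope.
Local Open Scope card_scope.

(* Simple undirected graphs; the vertex type may be empty or infinite. *)
Record graph (V : Type) := Graph {
  adj : V -> V -> Prop;
  adj_sym : forall x y, adj x y -> adj y x;
  adj_irrefl : forall x, ~ adj x x
}.

Section GraphNotions.
Variables (V : Type) (G : graph V).

(* An edge is an unordered pair, encoded as the set of its two endpoints. *)
Definition edges : set (set V) :=
  [set e | exists x y, adj G x y /\ e = [set x; y]].

Definition locally_finite : Prop :=
  forall v, finite_set [set e | edges e /\ e v].

Definition bipartition (V1 V2 : set V) : Prop :=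
  [/\ V1 `|` V2 = setT, V1 `&` V2 = set0,
      forall x y, V1 x -> V1 y -> ~ adj G x y &
      forall x y, V2 x -> V2 y -> ~ adj G x y].

Definition neighborhood (J : set V) : set V :=
  [set y | exists2 x, J x & adj G x y].

Definition perfect_matching (M : set (set V)) : Prop :=
  M `<=` edges /\ forall v, exists! e, M e /\ e v.

Definition graph_derangement (f : V -> V) : Prop :=
  injective f /\ forall v, adj G (f v) v.

End GraphNotions.

Section Cycles.
Variables (V : Type) (f : V -> V).

Definition same_cycle (x y : V) : Prop :=
  exists m n : nat, [/\ 0 < m, 0 < n & iter m f x = iter n f y].

Definition cycles : set (set V) :=
  [set C | exists x, C = [set y | same_cycle x y]].

Definition dyadic : Prop := forall C, cycles C -> C #<= `I_2.

End Cycles.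

(* Main.v *)
Require Import Defs.
From HB Require Import structures.
From mathcomp Require Import all_boot finmap.
From mathcomp Require Import boolp classical_sets functions cardinality.

(** For (iv) => (i), local finiteness lets Marshall Hall's theorem, proved here
    by Rado's minimality argument, turn (iv) into an injective [f] with
    [f v ~ v].  In the bipartite case such an [f] consists of an
    injection of each side into the other, and the Cantor-Bernstein argument
    selects a set [S] of vertices such that the edges [{v, f v}], [v] in [S],
    form a perfect matching. *)

Set Implicit Arguments.
Unset Strict Implicit.
Unset Printing Implicit Defensive.

(** * Marshall Hall's theorem for families of finite sets *)

Section Hall.
Local Open Scope fset_scope.
Variables I T : choiceType.
Implicit Types (Q : I -> {fset T}) (J : {fset I}).

Definition hall_condition Q :=
  forall J, (#|` J| <= #|` \bigcup_(i <- J) Q i|)%N.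

(** [Q'] is the smaller family: with inclusion reversed in this way, a maximal element for Zorn's
    lemma is a minimal family. *)
Definition refines Q Q' := forall i, Q' i `<=` Q i.

Definition delete_at (i : I) (x : T) Q : I -> {fset T} :=
  fun j => if j == i then (Q j `\ x) else Q j.

Lemma delete_at_refines i x Q : refines Q (delete_at i x Q).
Proof.
by move=> j; rewrite /delete_at; case: eqP => _ //; apply: fsubD1set.
Qed.

(** A set avoiding [i] has the same union before and after the deletion, so only a set containing
    [i] can violate the condition. *)
Lemma delete_at_violation Q i x :
  hall_condition Q -> ~ hall_condition (delete_at i x Q) ->
  exists2 J : {fset I}, i \in J &
    (#|` \bigcup_(j <- J) delete_at i x Q j| < #|` J|)%N.
Proof.
move=> hQ /existsNP[J /negP]; rewrite -ltnNge => ltJ; exists J => //.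
apply/negPn/negP => iJ; move: ltJ; rewrite ltnNge.
rewrite (_ : (\bigcup_(j <- J) _) = (\bigcup_(j <- J) Q j)) ?hQ //.
apply: eq_big_seq => j jJ; rewrite /delete_at.
by case: eqP => // ji; rewrite -ji jJ in iJ.
Qed.

(* Were both deletions to violate the condition, on [J1] and
   on [J2], submodularity of the size of the neighborhood would make [Q]
   violate it on [J1 `|` J2] or on [(J1 `&` J2) `\ i]. *)
Lemma hall_delete Q i x y : hall_condition Q -> x != y ->
  hall_condition (delete_at i x Q) \/ hall_condition (delete_at i y Q).
Proof.
move=> hQ xy; apply: contrapT => /not_orP[].
move=> /(delete_at_violation hQ)[J1 iJ1 lt1].
move=> /(delete_at_violation hQ)[J2 iJ2 lt2].
set A1 := (\bigcup_(j <- J1) _) in lt1.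
set A2 := (\bigcup_(j <- J2) _) in lt2.
have memA z (J : {fset I}) j w : j \in J -> w \in Q j ->
    (j == i -> w != z) -> w \in (\bigcup_(k <- J) delete_at i z Q k).
  move=> jJ wQ wz; apply/bigfcupP; exists j; first by rewrite jJ.
  rewrite /delete_at; case: eqP => // /eqP/wz wNz.
  by rewrite !inE wNz.
have leU : (#|` J1 `|` J2| <= #|` A1 `|` A2|)%N.
  apply: leq_trans (hQ _) (fsubset_leq_card _).
  apply/fsubsetP => w /bigfcupP[j]; rewrite andbT !in_fsetU => jJ wQ.
  have [ji|jNi] := eqVneq j i.
    (* At the index [i], [x] survives in [A2] and every other element in [A1]. *)
    have [wx|wNx] := eqVneq w x.
      apply/orP; right; apply: (memA y J2 j w) => //; first by rewrite ji.
      by rewrite wx.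
    by apply/orP; left; apply: (memA x J1 j w) => //; rewrite ji.
  case/orP: jJ => jJ; apply/orP; [left|right].
    by apply: (memA _ _ j) => //; rewrite (negPf jNi).
  by apply: (memA _ _ j) => //; rewrite (negPf jNi).
have leI : (#|` (J1 `&` J2) `\ i| <= #|` A1 `&` A2|)%N.
  apply: leq_trans (hQ _) (fsubset_leq_card _).
  apply/fsubsetP => w /bigfcupP[j].
  rewrite andbT !inE => /and3P[jNi jJ1 jJ2] wQ.
  by apply/andP; split; apply: (memA _ _ j) => //; rewrite (negPf jNi).
have iJ : i \in (J1 `&` J2) by rewrite inE iJ1.
(* Removing [i] costs one, so the sizes of [J1] and [J2] add up to at most one more than those of
   [A1] and [A2]; [lt1] and [lt2] force a gap of two. *)
have EJ := cardfsD1 i (J1 `&` J2); rewrite iJ add1n in EJ.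
have := leq_add leU leI.
rewrite cardfsUI -ltnS -addnS -EJ cardfsUI => leJ.
by have := leq_trans (leq_add lt1 lt2) leJ; rewrite addnS addSn ltnS ltnn.
Qed.

(* A decreasing chain of finite sets is eventually constant, so on any finite
   index set the intersection of the chain agrees with some member. *)
Lemma hall_chain (C : set (I -> {fset T})) : (C !=set0)%classic ->
  (forall Q, C Q -> hall_condition Q) -> total_on C refines ->
  exists2 L, hall_condition L & forall Q, C Q -> refines Q L.
Proof.
move=> [Q0 CQ0] hC totC.
have least i : exists P, C P /\ forall Q, C Q -> (P i `<=` Q i).
  (* By totality, a member whose set at [i] has least size lies inside every other member at [i]. *)
  pose p n := `[< exists2 Q, C Q & #|` Q i| = n >].
  have exp : exists n, p n by exists #|` Q0 i|; apply/asboolP; exists Q0.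
  case: (ex_minnP exp) => n /asboolP[P CP Pn] minn; exists P; split=> // Q CQ.
  case: (totC _ _ CP CQ) => [|/(_ i)//] /(_ i) QP.
  have /eqP -> // : P i == Q i.
  by rewrite eq_sym eqEfcard QP Pn; apply: minn; apply/asboolP; exists Q.
have [P /all_and2[CP leP]] := choice least.
exists (fun i => P i i) => [J|Q CQ i]; last exact: leP.
suff [Q CQ QJ] : exists2 Q, C Q & {in J, forall i, (Q i `<=` P i i)}.
  apply: leq_trans (hC Q CQ J) (fsubset_leq_card _).
  apply/bigfcupsP => i iJ _; apply: fsubset_trans (QJ i iJ) _.
  exact: bigfcup_sup.
elim/finSet_rect: J => J IH.
have [->|[i iJ]] := fset_0Vmem J; first by exists Q0.
have [Q CQ QJ] := IH _ (fproperD1 iJ).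
(* The smaller of [Q] and [P i] serves on all of [J]. *)
case: (totC _ _ CQ (CP i)) => le.
  exists (P i) => // j jJ; have [->//|ji] := eqVneq j i.
  by apply: fsubset_trans (le j) (QJ j _); rewrite !inE ji.
exists Q => // j jJ; have [->//|ji] := eqVneq j i.
by apply: QJ; rewrite !inE ji.
Qed.

(** Zorn's lemma gives a minimal family [P] below [Q] satisfying the condition. By [hall_delete] a
    set with two elements could be shrunk, so each [P i] has at most one. The condition on one index
    makes [P i] nonempty, and on two indices it makes the chosen elements distinct. *)
Theorem hall_marriage Q : hall_condition Q ->
  exists2 f : I -> T, injective f & forall i, f i \in Q i.
Proof.
move=> hQ; pose X := {P | hall_condition P /\ refines Q P}.
pose R (P P' : X) := `[< refines (sval P) (sval P') >].
have refl t : R t t by apply/asboolP => i.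
have trans r s t : R r s -> R s t -> R r t.
  move=> /asboolP rs /asboolP st; apply/asboolP => i.
  exact: fsubset_trans (st i) (rs i).
have QX : hall_condition Q /\ refines Q Q by split=> // i.
have [|[P [hP QP]] maxP] := @ZL_preorder X (exist _ Q QX) R refl trans.
  move=> A totA; have [->|/set0P[P0 AP0]] := eqVneq A set0.
    by exists (exist _ Q QX).
  have [|||L hL leL] := @hall_chain [set sval P | P in A]%classic.
  - by exists (sval P0); exists P0.
  - by move=> _ [P _ <-]; case: (svalP P).
  - move=> _ _ [P AP <-] [P' AP' <-].
    by case: (totA _ _ AP AP') => /asboolP; [left|right].
  have QL : refines Q L.
    move=> i; apply: fsubset_trans (leL (sval P0) _ i) _; first by exists P0.
    by case: (svalP P0).
  exists (exist _ L (conj hL QL)) => P AP; apply/asboolP => i.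
  by apply: leL; exists P.
have minP P' : hall_condition P' -> refines P P' -> refines P' P.
  move=> hP' PP'; have QP' : refines Q P'.
    by move=> i; apply: fsubset_trans (PP' i) (QP i).
  by have /asboolP := maxP (exist _ P' (conj hP' QP')) (asboolT PP').
have P1 i x y : x \in P i -> y \in P i -> x = y.
  move=> xP yP; apply/eqP/negPn/negP => xy.
  have deletable z : z \in P i -> ~ hall_condition (delete_at i z P).
    move=> zP hz; have := minP _ hz (@delete_at_refines i z P) i.
    by move=> /fsubsetP/(_ z zP); rewrite /delete_at eqxx !inE eqxx.
  by case: (hall_delete i hP xy) => /deletable; apply.
have [i|f fP] := @choice I T (fun i x => x \in P i).
  have := hP [fset i]; rewrite cardfs1 big_seq_fset1 cardfs_gt0.
  by case/fset0Pn => x; exists x.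
exists f => [i j fij|i]; last exact: (fsubsetP (QP i)).
apply/eqP/negPn/negP => ij; have := hP [fset i; j].
rewrite cardfs2 ij leqNgt => /negP; apply.
apply: leq_ltn_trans (_ : #|` [fset f i]| < 2)%N; last by rewrite cardfs1.
apply: fsubset_leq_card; apply/bigfcupsP => k; rewrite !inE => + _.
move=> kij; apply/fsubsetP => x xP; rewrite inE; apply/eqP.
by case/orP: kij => /eqP Ek; rewrite Ek in xP;
  [apply: (P1 i) | rewrite fij; apply: (P1 j)].
Qed.

End Hall.

Local Open Scope classical_set_scope.
Local Open Scope card_scope.

(** * Matchings, derangements and the cardinality condition *)

Section Matchings.
Variables (V : Type) (G : graph V).

(** Iterates of [f] depend only on the parity of the exponent, so the class of [x] contains at most
    [x] and [f x]. *)
Lemma involution_dyadic (f : V -> V) : involutive f -> dyadic f.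
Proof.
move=> ff _ [x ->].
pose g n := if n == 0%N then x else f x.
suff sub : [set y | same_cycle f x y] `<=` [set g n | n in `I_2].
  exact: card_le_trans (subset_card_le sub) (card_image_le _ _).
have iterE n y : iter n f y = if odd n then f y else y.
  by elim: n => //= n ->; case: (odd n).
move=> y [m [n [_ _]]]; rewrite !iterE.
have [xg fxg] : [set g n | n in `I_2] x /\ [set g n | n in `I_2] (f x).
  by split; [exists 0%N | exists 1%N].
case: (odd m) (odd n) => [] [] E; last by rewrite -E.
- by rewrite -(can_inj ff E).
- by rewrite -E.
- by rewrite -(ff y) -E.
Qed.

(** [f v] is the other end of the edge of [M] at [v]; uniqueness at [f v] identifies this edge with
    the one chosen there, whence [f (f v) = v]. *)
Lemma perfect_matching_involution (M : set (set V)) :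
  perfect_matching G M ->
  exists f : V -> V, involutive f /\ forall v, adj G (f v) v.
Proof.
move=> [Medge Mex].
have /choice[f fP] : forall v, exists w, adj G w v /\ M [set v; w].
  move=> v; have [e [[Me ev] _]] := Mex v.
  have [x [y [xy exy]]] := Medge e Me; rewrite exy in Me ev.
  case: ev => ->; first by exists y; split=> //; apply: adj_sym.
  by exists x; rewrite setUC.
exists f; split=> v; last by case: (fP v).
have [e [_ eU]] := Mex (f v).
have [advf Mv] := fP v; have [_ Mfv] := fP (f v).
have : [set v; f v] v by left.
rewrite -(eU [set v; f v]); last by split=> //; right.
rewrite (eU [set f v; f (f v)]); last by split=> //; left.
case=> // E; case: (adj_irrefl (g := G) (x := v)).
by rewrite {1}E.
Qed.

Lemma derangement_card_le (f : V -> V) (J : set V) :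
  graph_derangement G f -> J #<= neighborhood G J.
Proof.
move=> [injf adjf].
apply: (@card_le_trans _ _ _ (f @` J)).
  have /card_eqPle[] // := inj_card_eq (A := J) (in2W injf).
apply: subset_card_le => _ [x Jx <-]; exists x => //; exact: adj_sym.
Qed.

(** The map [e] sends the neighbors of [v] injectively to the edges at [v]. *)
Lemma locally_finite_neighborhood (v : V) :
  locally_finite G -> finite_set [set w | adj G v w].
Proof.
move=> /(_ v) fine; pose e w := [set v; w].
have einj : injective e.
  move=> w w' E; have : e w' w by rewrite -E; right.
  case=> // wv; have : e w w' by rewrite E; right.
  by case=> ->.
apply: sub_finite_set (finite_preimage (in2W einj) fine) => w vw /=.
by split; [exists v, w | left].
Qed.

Lemma hall_derangement : locally_finite G ->
  (forall J : set V, J #<= neighborhood G J) ->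
  exists f : V -> V, graph_derangement G f.
Proof.
move=> lfG hG.
(* [{classic V}] gives [V] the choice structure that finite sets require. *)
pose Q (v : {classic V}) : {fset {classic V}} :=
  fset_set ([set w | adj G v w] : set {classic V}).
have QE v w : (w \in Q v) = `[< adj G v w >].
  by rewrite in_fset_set ?inE //; apply: locally_finite_neighborhood.
have hQ : hall_condition Q.
  move=> J; rewrite -card_le_II.
  have card_fsetE (A : {fset {classic V}}) : [set` A] #= `I_(#|` A|).
    exact/card_eq_fsetP.
  rewrite -(card_le_eql (card_fsetE J)) -(card_le_eqr (card_fsetE _)).
  apply: card_le_trans (hG [set` J]) (subset_card_le _) => w [v /= vJ vw].
  by apply/bigfcupP; exists v; rewrite ?andbT // QE; apply/asboolP.
have [f injf fQ] := hall_marriage hQ.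
exists f; split=> // v; apply: adj_sym.
by have := fQ v; rewrite QE => /asboolP.
Qed.

(* [S] is to be the set of vertices that are matched with their image. The
   Cantor-Bernstein set [A] consists of the points of [V1] with an even number
   of ancestors. *)
Lemma derangement_selector (V1 V2 : set V) (f : V -> V) :
  bipartition G V1 V2 -> graph_derangement G f ->
  exists S : set V, forall v, S v <-> ~ exists2 u, S u & f u = v.
Proof.
move=> [V12 dV indep1 indep2] [injf adjf].
have V2E v : V2 v <-> ~ V1 v.
  split=> [V2v V1v|nV1v]; first by have : (V1 `&` V2) v by []; rewrite dV.
  by have [] : (V1 `|` V2) v by rewrite V12.
have V1f v : V1 (f v) <-> ~ V1 v.
  split=> [V1fv V1v|/V2E V2v]; first exact: indep1 V1fv V1v (adjf v).
  by apply: contrapT => /V2E V2fv; apply: indep2 V2fv V2v (adjf v).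
pose A v := exists n x, [/\ V1 x, ~ range f x & v = iter n.*2 f x].
have AS v : A v -> A (f (f v)).
  by move=> [n [x [V1x Rx ->]]]; exists n.+1, x.
(* Points of [A] go with their image in [V2]; the rest of [V1] is covered by the points of [V2] that
   [f] sends outside [A]. *)
exists [set v | A v \/ V2 v /\ ~ A (f v)] => v.
have A1 v' : A v' -> V1 v'.
  move=> [n [x [V1x _ ->]]]; elim: n => //= n IH.
  by apply/V1f => /V1f.
split=> [Sv [u Su fuv]|nS].
  rewrite -fuv in Sv; case: Su Sv => [Au|[V2u nAfu]].
    case=> [/A1/V1f|[_]]; first by apply; apply: A1.
    by apply; apply: AS.
  case=> // -[/V2E nV1fu _]; apply: nV1fu; apply/V1f; exact/V2E.
have [V1v|nV1v] := pselect (V1 v).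
  left; apply: contrapT => nAv; apply: nS.
  have [u _ fuv] : range f v.
    by apply: contrapT => Rv; apply: nAv; exists 0%N, v.
  exists u => //; right; rewrite fuv; split=> //.
  by apply/V2E; apply/V1f; rewrite fuv.
right; split; first exact/V2E.
(* If [f v] were in [A], it would not be a starting point [x], being in the range, so [v] would be
   the image of a point of [A]. *)
move=> [[|n] [x [V1x Rx]]] /= E; first by apply: Rx; exists v.
by apply: nS; exists (iter n.*2 f x); [left; exists n, x|apply/injf].
Qed.

(** [S] and its image under [f] partition the vertices, and [f] is injective, so each vertex is an
    end of exactly one chosen edge. *)
Lemma selector_perfect_matching (f : V -> V) (S : set V) :
  graph_derangement G f ->
  (forall v, S v <-> ~ exists2 u, S u & f u = v) ->
  perfect_matching G [set [set v; f v] | v in S].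
Proof.
move=> [injf adjf] SP; split.
  by move=> _ [v _ <-]; exists v, (f v); split=> //; apply: adj_sym.
move=> v; have [Sv|nSv] := pselect (S v).
  exists [set v; f v]; split; first by split; [exists v | left].
  move=> _ [[u Su <-]] [->//|vfu].
  by case: (proj1 (SP v) Sv); exists u.
have [u Su fuv] : exists2 u, S u & f u = v.
  by apply: contrapT => /SP.
exists [set u; f u]; split; first by split; [exists u | right].
move=> _ [[w Sw <-]] [vw|vfw]; first by rewrite vw in nSv.
by have /injf -> : f u = f w by rewrite fuv.
Qed.

End Matchings.

Theorem theorem13 (V : Type) (G : graph V) (V1 V2 : set V)
    (lfG : locally_finite G) (bipG : bipartition G V1 V2) :
  [<-> exists M : set (set V), perfect_matching G M;
       exists f : V -> V, graph_derangement G f /\ dyadic f;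
       exists f : V -> V, graph_derangement G f;
       forall J : set V, J #<= neighborhood G J].
Proof.
tfae=> [[M]|[f [fG _]]|[f fG] J|hG].
- move=> /perfect_matching_involution[f [ff fG]]; exists f.
  by split; [split; [exact: can_inj ff|]|exact: involution_dyadic].
- by exists f.
- exact: derangement_card_le fG.
- have [f fG] := hall_derangement lfG hG.
  have [S SP] := derangement_selector bipG fG.
  by exists [set [set v; f v] | v in S]; apply: selector_perfect_matching.
Qed.
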